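(* Let $k\ge 1$ and let $G$ be a compact semialgebraic Lie group. Suppose that $w_{G,k}^{-1}(1)=\{(x_1,\ldots,x_k)\in G^k:[x_1,\ldots,x_k]=1\}$ has positive Haar measure in $G^k$. Then $G$ has a clopen finite index subgroup which is nilpotent of class at most $k-1$.
   Context: A semialgebraic Lie group is a Lie group whose underlying set and group operation are semialgebraic, i.e. definable in the ordered field of real numbers. The Haar measure on $G^k$ is the normalized Haar measure of the compact group $G^k$. Left normed commutators: $[x_1]=x_1$, $[x_1,\ldots,x_{k+1}]=[[x_1,\ldots,x_k],x_{k+1}]$. Nilpotent of class $0$ means trivial. *)

(* Defs.v *)
From HB Require Import structures.
From mathcomp Require Import all_boot all_order all_algebra.
From mathcomp Require Import all_classical all_reals all_analysis.
From mathcomp Require ordered_qelim.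

Set Implicit Arguments.
Unset Strict Implicit.
Unset Printing Implicit Defensive.

Import Order.TTheory GRing.Theory Num.Theory.
Import numFieldNormedType.Exports.
Import ordered_qelim (ord.formula, ord.holds).

Local Open Scope classical_set_scope.
Local Open Scope group_scope.

(** * Topological groups *)

HB.mixin Record isTopGroup G of Group G & Topological G := {
  mulg_continuous : continuous (fun z : G * G => z.1 * z.2);
  invg_continuous : continuous (fun x : G => x^-1)
}.

#[short(type="topGroupType")]
HB.structure Definition TopGroup :=
  {G of Group G & Topological G & isTopGroup G}.

Definition power (G : Type) (k : nat) : Type := prod_topology (fun _ : 'I_k => G).

HB.instance Definition _ (G : topologicalType) k := Topological.on (power G k).

Section power_group.
Variables (G : topGroupType) (k : nat).
Implicit Types x y z : power G k.

Let pone : power G k := fun=> 1.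
Let pinv x : power G k := fun i => (x i)^-1.
Let pmul x y : power G k := fun i => x i * y i.

Fact power_mulgA : associative pmul.
Proof. by move=> x y z; apply: funext => i; exact: mulgA. Qed.
Fact power_mul1g : left_id pone pmul.
Proof. by move=> x; apply: funext => i; exact: mul1g. Qed.
Fact power_mulg1 : right_id pone pmul.
Proof. by move=> x; apply: funext => i; exact: mulg1. Qed.
Fact power_mulVg : left_inverse pone pinv pmul.
Proof. by move=> x; apply: funext => i; exact: mulVg. Qed.
Fact power_mulgV : right_inverse pone pinv pmul.
Proof. by move=> x; apply: funext => i; exact: mulgV. Qed.

HB.instance Definition _ := isGroup.Build (power G k)
  power_mulgA power_mul1g power_mulg1 power_mulVg power_mulgV.

Let proj_cts (i : 'I_k) : continuous (fun x : power G k => x i).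
Proof. exact: (@proj_continuous _ (fun _ : 'I_k => G) i). Qed.

Let to_power_cts (T : topologicalType) (f : T -> power G k) :
  (forall i, continuous (fun t => f t i)) -> continuous f.
Proof.
move=> fc t; apply/cvg_sup => i.
exact: (@continuous_comp_initial _ _ _ (fun x : power G k => x i) f (fc i)).
Qed.

Fact power_mul_continuous : continuous (fun z : power G k * power G k => z.1 * z.2).
Proof.
apply: to_power_cts => i z.
have cf : {for z, continuous (fun z : power G k * power G k => (z.1 i, z.2 i))}.
  apply: cvg_pair.
  - exact: (@continuous_comp _ _ _ fst (fun x : power G k => x i) z cvg_fst
      (@proj_cts i _)).
  - exact: (@continuous_comp _ _ _ snd (fun x : power G k => x i) z cvg_snd
      (@proj_cts i _)).
exact: (@continuous_comp _ _ _ _ (fun w : G * G => w.1 * w.2) z cf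
  (@mulg_continuous G _)).
Qed.

Fact power_inv_continuous : continuous (fun x : power G k => x^-1).
Proof.
apply: to_power_cts => i x.
exact: (@continuous_comp _ _ _ _ (fun y : G => y^-1) x (@proj_cts i x)
  (@invg_continuous G _)).
Qed.

HB.instance Definition _ :=
  isTopGroup.Build (power G k) power_mul_continuous power_inv_continuous.

End power_group.

(** * Haar measure *)

(* [measurableType] demands a base point; we take the neutral element. *)
Definition pointed_at1 (X : Type) : Type := X.
HB.instance Definition _ (X : topGroupType) := Choice.on (pointed_at1 X).
HB.instance Definition _ (X : topGroupType) := isPointed.Build (pointed_at1 X) (1 : X).

Definition borel (X : topGroupType) :=
  @g_sigma_algebraType (pointed_at1 X) (@open X).

Record is_haar (R : realType) (X : topGroupType) (mu : probability (borel X) R) :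
    Prop := IsHaar {
  haar_left_invariant : forall (g : X) (A : set (borel X)), measurable A ->
    mu [set g * x | x in (A : set X)] = mu A;
  haar_outer_regular : forall A : set (borel X), measurable A ->
    mu A = ereal_inf [set mu U | U in [set U : set X | open U /\ A `<=` U]];
  haar_inner_regular : forall U : set X, open U ->
    mu U = ereal_sup [set mu K | K in [set K : set X | compact K /\ K `<=` U]]
}.

(** * Lie groups *)

Section smooth.
Variables (R : realType) (V W : normedModType R).

(* For [D] open, [forall n, C_on n D f] says that [f] is C^oo on [D]: all
   iterated directional derivatives exist and are continuous on [D]. *)
Fixpoint C_on (n : nat) (D : set V) (f : V -> W) : Prop :=
  (forall x, D x -> {for x, continuous f}) /\
  (if n is n'.+1 then
     forall v, (forall x, D x -> derivable f x v) /\ C_on n' D (fun x => 'D_v f x)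
   else True).

Definition smooth_on (D : set V) (f : V -> W) := forall n, C_on n D f.

End smooth.

Record chart (R : realType) (d : nat) (G : topologicalType) := Chart {
  dom : set G;
  phi : G -> 'rV[R]_d;
  psi : 'rV[R]_d -> G;
  open_dom : open dom;
  open_img : open (phi @` dom);
  chartK : forall x, dom x -> psi (phi x) = x;
  phi_continuous : forall x, dom x -> {for x, continuous phi};
  psi_continuous : forall y, (phi @` dom) y -> {for y, continuous psi}
}.

Definition img (R : realType) (d : nat) (G : topologicalType) (c : chart R d G) :=
  phi c @` dom c.

Definition smooth_atlas (R : realType) (d : nat) (G : topologicalType)
    (A : set (chart R d G)) :=
  (forall x, exists2 c, A c & dom c x) /\
  (forall c c', A c -> A c' ->
    smooth_on (phi c @` (dom c `&` dom c')) (phi c' \o psi c)).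

Definition smooth_mul (R : realType) (d : nat) (G : topGroupType)
    (A : set (chart R d G)) :=
  forall c1 c2 c3, A c1 -> A c2 -> A c3 ->
    smooth_on [set z : 'rV[R]_d * 'rV[R]_d |
                 [/\ img c1 z.1, img c2 z.2 & dom c3 (psi c1 z.1 * psi c2 z.2)]]
              (fun z => phi c3 (psi c1 z.1 * psi c2 z.2)).

Definition smooth_inv (R : realType) (d : nat) (G : topGroupType)
    (A : set (chart R d G)) :=
  forall c1 c2, A c1 -> A c2 ->
    smooth_on [set y : 'rV[R]_d | img c1 y /\ dom c2 (psi c1 y)^-1]
              (fun y => phi c2 (psi c1 y)^-1).

Definition lie_group (R : realType) (G : topGroupType) : Prop :=
  [/\ hausdorff_space G, @second_countable G &
      exists (d : nat) (A : set (chart R d G)),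
        [/\ smooth_atlas A, smooth_mul A & smooth_inv A]].

(** * Semialgebraic Lie groups *)

(* Definability by a first-order formula with parameters in [R]. *)
Definition semialgebraic (R : realType) (n : nat) (A : set 'rV[R]_n) : Prop :=
  exists f : ord.formula R,
    forall x : 'rV[R]_n, A x <-> ord.holds [seq x ord0 i | i <- enum 'I_n] f.

(* The carrier is identified with a subset of [R^n] by an injection [iota].  No
   relation is imposed between the topology of [G] and that of [R^n]: the
   topology of a definable group is in general not the subspace topology,
   e.g. for [0, 1[ with addition modulo 1. *)
Definition semialgebraic_group (R : realType) (G : groupType) : Prop :=
  exists (n : nat) (iota : G -> 'rV[R]_n),
    [/\ injective iota,
        semialgebraic (range iota) &
        semialgebraic [set row_mx (row_mx (iota z.1) (iota z.2)) (iota (z.1 * z.2))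
                      | z in [set: G * G]]].

Definition semialgebraic_lie_group (R : realType) (G : topGroupType) : Prop :=
  lie_group R G /\ semialgebraic_group R G.

(** * Commutators, subgroups and nilpotency *)

(* [left_normed [:: x1; ...; xk]] is [x1, ..., xk], with
   [x, y] = x^-1 y^-1 x y; the empty sequence is a dummy case. *)
Definition left_normed (G : groupType) (s : seq G) : G :=
  if s is x :: s' then foldl (fun a b => [~ a, b]) x s' else 1.

Definition comm_word (G : topGroupType) (k : nat) (x : power G k) : G :=
  left_normed [seq x i | i <- enum 'I_k].

Definition subgroup (G : groupType) (H : set G) : Prop := group_closed [in H].

Definition finite_index (G : groupType) (H : set G) : Prop :=
  finite_set [set [set g * h | h in H] | g in [set: G]].

Fixpoint lower_central (G : groupType) (H : set G) (n : nat) : set G :=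
  if n is n'.+1 then
    smallest (@subgroup G) [set [~ x, y] | x in lower_central H n' & y in H]
  else H.

Definition nilpotent_of_class_le (G : groupType) (c : nat) (H : set G) : Prop :=
  subgroup H /\ lower_central H c = [set 1].

(* Main.v *)
Require Import Defs.
From HB Require Import structures.
From mathcomp Require Import all_boot all_order all_algebra.
From mathcomp Require Import all_classical all_reals all_analysis.

(** The coordinates of the commutator [x_1, ..., x_k] are peeled off one at a time,
last one first, each at the price of one step in a central series relative to
the least open subgroup of G.

Let H be the intersection of all open subgroups of G.  A chart at 1 yields
connected sets filling a neighbourhood of 1, and a connected set through 1 lies
in every open (hence clopen) subgroup; so H is itself open
([open_open_core]), it is the least open subgroup, and it is normal.  It has
finite index because G is compact.

Put Z_0 = 1 and let Z_(m+1) consist of the g such that [g, h] is in Z_m for all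
h in H.  Each Z_m is a closed normal subgroup.  Suppose that
[x_1, ..., x_(n+1)] lies in Z_m for a set of x of positive measure.  When
x_1, ..., x_n are fixed, with w = [x_1, ..., x_n], the admissible x_(n+1) form
the closed subgroup {y | [w, y] in Z_m}.  Heuristically, by Fubini, for a set of
(x_1, ..., x_n) of positive measure this subgroup has positive measure, hence is
open, hence contains H, which says that w lies in Z_(m+1).  Iterating from
m = 0, one reaches Z_(k-1) of positive measure, so that H is contained in
Z_(k-1) ([open_core_sub_relative_center]).  Then the lower central series of H
descends at least as fast as the Z_m, and H is nilpotent of class at most k-1
([nilpotent_relative_center]).

The measure-theoretic step ([fiber_measure_le]) works directly with the Haar
measure of G^k, without writing it as a product.  Take a sequence g_0, g_1, ...
dense in G and let B_n be the set of those x in the family for which the coset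
of the fibre subgroup by g_n differs from those by g_0, ..., g_(n-1).
The translates g_n B_n, in the last coordinate, are pairwise disjoint, so by
invariance the measures of the B_n have sum at most 1.  By Borel-Cantelli,
almost every x lies in finitely many B_n; then finitely many closed cosets of
its fibre subgroup cover a dense set, hence all of G, and the fibre subgroup is
open. *)

Set Implicit Arguments.
Unset Strict Implicit.
Unset Printing Implicit Defensive.

Import Order.TTheory GRing.Theory Num.Theory.
Import numFieldNormedType.Exports.

Local Open Scope classical_set_scope.
Local Open Scope group_scope.

(** * Subgroups and commutators *)

Lemma subgroupE (G : groupType) (H : set G) :
  subgroup H <-> H 1 /\ (forall x y, H x -> H y -> H (x * y^-1)).
Proof.
split=> [[H1 Hd]|[H1 Hd]].
  split; first by move: H1; rewrite inE.
  by move=> x y Hx Hy; have := Hd x y; rewrite !inE; exact.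
split; first by rewrite inE.
by move=> x y; rewrite !inE; exact: Hd.
Qed.

Lemma subgroup1 (G : groupType) (H : set G) : subgroup H -> H 1.
Proof. by move=> /subgroupE[]. Qed.

Lemma subgroupV (G : groupType) (H : set G) x : subgroup H -> H x -> H x^-1.
Proof. by move=> /subgroupE[H1 Hd] Hx; rewrite -[x^-1]mul1g; exact: Hd. Qed.

Lemma subgroupM (G : groupType) (H : set G) x y :
  subgroup H -> H x -> H y -> H (x * y).
Proof.
move=> sH Hx Hy; rewrite -[y]invgK; have [_] := (subgroupE H).1 sH.
by apply=> //; exact: subgroupV.
Qed.

Lemma subgroupW (G : groupType) (H : set G) :
  H 1 -> (forall x y, H x -> H y -> H (x * y)) -> (forall x, H x -> H x^-1) ->
  subgroup H.
Proof. by move=> H1 HM HV; apply/subgroupE; split=> // x y Hx /HV; exact: HM. Qed.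

Lemma subgroup_bigcap (G : groupType) (P : set (set G)) :
  P `<=` @subgroup G -> subgroup (\bigcap_(K in P) K).
Proof.
move=> sP; apply: subgroupW => [K /sP|x y xP yP K PK|x xP K PK].
- exact: subgroup1.
- by apply: subgroupM; [exact: sP|exact: xP|exact: yP].
- by apply: subgroupV; [exact: sP|exact: xP].
Qed.

(** Stability under conjugation by the whole group: normality, for a subgroup. *)
Definition conj_stable (G : groupType) (N : set G) :=
  forall x g, N x -> N (x ^ g).

Lemma commMgJ (G : groupType) (x y z : G) : [~ x * y, z] = [~ x, z] ^ y * [~ y, z].
Proof. by rewrite /commg /conjg !invgM !mulgA mulgK !mulgK. Qed.

Lemma commgMJ (G : groupType) (x y z : G) : [~ x, y * z] = [~ x, z] * [~ x, y] ^ z.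
Proof. by rewrite -[LHS]invgK invgR commMgJ invgM -conjVg !invgR. Qed.

Lemma commVgJ (G : groupType) (x y : G) : [~ x^-1, y] = ([~ x, y]^-1) ^ x^-1.
Proof. by rewrite /commg /conjg !invgM !invgK !mulgA mulgK. Qed.

Lemma commgVJ (G : groupType) (x y : G) : [~ x, y^-1] = ([~ x, y]^-1) ^ y^-1.
Proof. by rewrite invgR /commg /conjg invgK !mulgA mulgV mul1g. Qed.

(** For N normal, this is the preimage in G of the centralizer of the image of S
in G / N; phrasing it with commutators avoids forming the quotient. *)
Definition commutant (G : groupType) (S N : set G) : set G :=
  [set g | forall s, S s -> N [~ g, s]].

Lemma subgroup_commutant (G : groupType) (S N : set G) :
  subgroup N -> conj_stable N -> subgroup (commutant S N).
Proof.
move=> sN nN; apply: subgroupW => [s _|x y xC yC s Ss|x xC s Ss].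
- by rewrite comm1g; exact: subgroup1.
- by rewrite commMgJ; apply: subgroupM => //; [apply: nN; exact: xC|exact: yC].
- by rewrite commVgJ; apply: nN; apply: subgroupV => //; exact: xC.
Qed.

Lemma conj_stable_commutant (G : groupType) (S N : set G) :
  conj_stable S -> conj_stable N -> conj_stable (commutant S N).
Proof.
move=> nS nN x g xC s Ss.
by rewrite -[s](conjgKV g) -conjRg; apply: nN; apply: xC; exact: nS.
Qed.

(** The solutions y of [w, y] in N are the preimage of the centralizer of the
image of w in G / N. *)
Lemma subgroup_commutator_into (G : groupType) (N : set G) w :
  subgroup N -> conj_stable N -> subgroup [set y | N [~ w, y]].
Proof.
move=> sN nN; apply: subgroupW => /= [|x y xC yC|x xC].
- by rewrite commg1; exact: subgroup1.
- by rewrite commgMJ; apply: subgroupM => //; exact: nN.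
- by rewrite commgVJ; apply: nN; exact: subgroupV.
Qed.

(** When H is the whole group this is the upper central series; in general, the
successive centralizers of H modulo the previous term. *)
Fixpoint relative_center (G : groupType) (H : set G) n : set G :=
  if n is n'.+1 then commutant H (relative_center H n') else [set 1].

Lemma relative_center_normal (G : groupType) (H : set G) n :
  conj_stable H ->
  subgroup (relative_center H n) /\ conj_stable (relative_center H n).
Proof.
move=> nH; elim: n => [|n [sZ nZ]] /=.
  split; last by move=> x g ->; rewrite /= conj1g.
  by apply: subgroupW => //= [x y -> ->|x ->]; rewrite ?mulg1 ?invg1.
by split; [exact: subgroup_commutant|exact: conj_stable_commutant].
Qed.

(** Commutation with H moves one step down the series of relative centers, so
the lower central series of H falls at least as fast. *)
Lemma lower_central_sub (G : groupType) (H : set G) n i :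
  conj_stable H -> H `<=` relative_center H n -> (i <= n)%N ->
  lower_central H i `<=` relative_center H (n - i).
Proof.
move=> nH HZ; elim: i => [|i IH] ltin; first by rewrite subn0.
apply: smallest_sub.
  exact: (relative_center_normal _ nH).1.
move=> _ [x xL] [y Hy] <-.
by have := IH (ltnW ltin) _ xL; rewrite -(subnSK ltin) => /(_ y Hy).
Qed.

Lemma nilpotent_relative_center (G : groupType) (H : set G) n :
  subgroup H -> conj_stable H -> H `<=` relative_center H n ->
  nilpotent_of_class_le n H.
Proof.
move=> sH nH HZ; split=> //; apply/seteqP; split=> [x|_ ->].
  by move/(lower_central_sub nH HZ (leqnn n)); rewrite subnn.
by case: n {HZ} => [|n]; [exact: subgroup1|move=> K [/subgroup1]].
Qed.

(** * Continuity and closed subgroups in topological groups *)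

Lemma continuous_mulgf (T : topologicalType) (G : topGroupType) (f g : T -> G) :
  continuous f -> continuous g -> continuous (fun t => f t * g t).
Proof.
move=> cf cg t.
apply: (@continuous_comp _ _ _ (fun t => (f t, g t)) (fun z => z.1 * z.2)).
  by apply: cvg_pair; [exact: cf|exact: cg].
exact: mulg_continuous.
Qed.

Lemma continuous_invgf (T : topologicalType) (G : topGroupType) (f : T -> G) :
  continuous f -> continuous (fun t => (f t)^-1).
Proof.
move=> cf t; apply: (@continuous_comp _ _ _ f (fun x => x^-1)).
  exact: cf.
exact: invg_continuous.
Qed.

Lemma continuous_commgf (T : topologicalType) (G : topGroupType) (f g : T -> G) :
  continuous f -> continuous g -> continuous (fun t => [~ f t, g t]).
Proof.
move=> cf cg; rewrite /commg /conjg.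
by do ![exact: continuous_invgf|apply: continuous_mulgf => //].
Qed.

Lemma closed_preimageT (S T : topologicalType) (f : S -> T) (A : set T) :
  continuous f -> closed A -> closed [set s | A (f s)].
Proof. by move=> cf; apply: preimage_closed => x _; exact: cf. Qed.

Lemma open_preimageT (S T : topologicalType) (f : S -> T) (A : set T) :
  continuous f -> open A -> open [set s | A (f s)].
Proof. by move=> cf; apply: open_comp => x _; exact: cf. Qed.

Lemma continuous_lmul (G : topGroupType) (g : G) : continuous (fun x => g * x).
Proof.
apply: continuous_mulgf; first exact: cst_continuous.
by move=> x; exact: cvg_id.
Qed.

(** Each step is an intersection, over H, of preimages under commutation. *)
Lemma closed_relative_center (G : topGroupType) (H : set G) n :
  closed [set 1 : G] -> closed (relative_center H n).
Proof.
move=> c1; elim: n => //= n IH.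
have -> : commutant H (relative_center H n) =
    \bigcap_(s in H) [set g | relative_center H n [~ g, s]] by [].
apply: closed_bigI => s _; apply: closed_preimageT IH.
by apply: continuous_commgf; [move=> x; exact: cvg_id|exact: cst_continuous].
Qed.

Lemma subgroup_coset (G : groupType) (H : set G) x y :
  subgroup H -> H (x^-1 * y) -> H x <-> H y.
Proof.
move=> sH Hxy; split=> [Hx|Hy].
  by rewrite -[y](mulVKg x); exact: subgroupM.
have -> : x = y * (x^-1 * y)^-1 by rewrite invgM invgK mulVKg.
by apply: subgroupM => //; exact: subgroupV.
Qed.

Lemma open_subgroup (G : topGroupType) (H : set G) :
  subgroup H -> nbhs 1 H -> open H.
Proof.
move=> sH H1; rewrite openE => x Hx.
have : nbhs x [set y | H (x^-1 * y)].
  by apply: (@continuous_lmul G x^-1 x); rewrite /= mulVg.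
by apply: filterS => y /= Hxy; exact: (subgroup_coset sH Hxy).1.
Qed.

(** The complement is a union of translates of the subgroup. *)
Lemma open_subgroup_closed (G : topGroupType) (H : set G) :
  subgroup H -> open H -> closed H.
Proof.
move=> sH oH; rewrite -openC.
have -> : ~` H = \bigcup_(x in ~` H) [set y | H (x^-1 * y)].
  apply/seteqP; split=> [x nHx|y [x nHx] /= Hxy Hy].
    by exists x => //=; rewrite mulVg; exact: subgroup1.
  by apply/nHx/(subgroup_coset sH Hxy).
apply: bigcup_open => x _.
exact: (open_preimageT (@continuous_lmul G x^-1)).
Qed.

(** The complement of H is the union of the finitely many cosets
that are not H, all closed. *)
Lemma closed_subgroup_open (G : topGroupType) (H : set G) (g : nat -> G) N :
  subgroup H -> closed H ->
  [set: G] `<=` \bigcup_(n in `I_N) [set x | H ((g n)^-1 * x)] -> open H.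
Proof.
move=> sH cH cov; rewrite -closedC.
have -> : ~` H =
    \bigcup_(n in `I_N `&` [set n | ~ H (g n)]) [set x | H ((g n)^-1 * x)].
  apply/seteqP; split=> [x nHx|y [n [_ /= nHg]] /= Hgy Hy].
    have [n nN /= Hx] := cov x I; exists n => //; split=> //= Hg.
    exact/nHx/(subgroup_coset sH Hx).
  by apply/nHg/(subgroup_coset sH Hgy).
apply: closed_bigcup => [|n _]; first exact/finite_setIl/finite_II.
exact: (closed_preimageT (@continuous_lmul G (g n)^-1)).
Qed.

(** * The least open subgroup *)

(** In a compact Lie group this is the identity component; as an intersection
it is visibly contained in every open subgroup. *)
Definition open_core (G : topGroupType) : set G :=
  \bigcap_(K in [set K | subgroup K /\ open K]) K.

Lemma subgroup_open_core (G : topGroupType) : subgroup (@open_core G).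
Proof. by apply: subgroup_bigcap => K []. Qed.

Lemma conj_stable_open_core (G : topGroupType) : conj_stable (@open_core G).
Proof.
move=> x g xC K [sK oK].
suff : [set y | K (y ^ g)] x by [].
apply: xC; split.
  apply: subgroupW => /= [|y z|y]; rewrite ?conj1g ?conjMg ?conjVg.
  - exact: subgroup1.
  - exact: subgroupM.
  - exact: subgroupV.
apply: open_preimageT oK; rewrite /conjg; apply: continuous_mulgf.
  exact: cst_continuous.
apply: continuous_mulgf; last exact: cst_continuous.
by move=> y; exact: cvg_id.
Qed.

Lemma connected_sub_open_core (G : topGroupType) (A : set G) :
  connected A -> A 1 -> A `<=` @open_core G.
Proof.
move=> cA A1 x Ax K [sK oK].
suff /seteqP[_ /(_ x Ax)[]//] : A `&` K = A.
apply: cA; first by exists 1; split=> //; exact: subgroup1.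
  by exists K.
by exists K => //; exact: open_subgroup_closed.
Qed.

(** A ball around the image of 1 fits in the image of the chart; its radii lift to
connected subsets of G through 1, which together fill a neighbourhood of 1. *)
Lemma open_open_core (R : realType) (d : nat) (G : topGroupType)
  (c : chart R d G) : dom c 1 -> open (@open_core G).
Proof.
move=> c1; apply: open_subgroup; first exact: subgroup_open_core.
have : nbhs (phi c 1) (phi c @` dom c).
  by apply: open_nbhs_nbhs; split; [exact: open_img|exists 1].
move=> /nbhs_ballP[e /= e0 eB].
have : nbhs (1 : G) (dom c `&` phi c @^-1` ball (phi c 1) e).
  apply: filterI; first by apply: open_nbhs_nbhs; split=> //; exact: open_dom.
  by apply: phi_continuous => //; exact: nbhsx_ballx.
apply: filterS => x [cx /= xB].
pose l (t : R) := (phi c 1%g + t *: (phi c x - phi c 1%g))%R.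
(* The segment [l] from the image of 1 to that of [x] stays in the ball. *)
have lB (t : R) : t \in `[0%R, 1%R]%R -> ball (phi c 1) e (l t).
  rewrite in_itv /= => /andP[t0 t1]; rewrite -ball_normE /ball_ /l /=.
  rewrite opprD addrA subrr add0r normrN normrZ ger0_norm//.
  move: xB; rewrite -ball_normE /ball_ /= distrC.
  by apply: le_lt_trans; rewrite ler_piMl.
have cl : continuous l.
  by move=> t; apply: cvgD; [exact: cvg_cst|apply: cvgZr_tmp; exact: cvg_id].
have : connected ((psi c \o l) @` `[0%R, 1%R]).
  apply: connected_continuous_connected; first exact: segment_connected.
  apply: continuous_in_subspaceT => t; rewrite inE => /lB /eB It.
  by apply: continuous_comp; [exact: cl|exact: psi_continuous].
move=> /connected_sub_open_core; apply.
  exists 0%R; first by rewrite /= in_itv /= lexx ler01.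
  by rewrite /l /= scale0r addr0 chartK.
exists 1%R; first by rewrite /= in_itv /= lexx ler01.
by rewrite /l /= scale1r addrC subrK chartK.
Qed.

(** The covering characterization of compactness needs a pointed topological
space. *)
HB.instance Definition _ (X : topGroupType) := Topological.on (pointed_at1 X).

Lemma finite_index_open (G : topGroupType) (H : set G) :
  compact [set: G] -> subgroup H -> open H -> finite_index H.
Proof.
move=> cG sH oH.
have : @compact (pointed_at1 G) [set: pointed_at1 G] by exact: cG.
rewrite compact_cover => /(_ G [set: G] (fun g => [set x | H (g^-1 * x)])).
case=> [g _|x _|s _ cov].
- exact: (open_preimageT (@continuous_lmul G g^-1)).
- by exists x => //=; rewrite mulVg; exact: subgroup1.
apply: sub_finite_set (finite_image (fun g : G => [set g * h | h in H])
  (finite_fset s)).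
move=> _ [x _ <-]; have [g /= gs Hgx] := cov x I; exists g => //.
have Hxg : H (x^-1 * g) by rewrite -[x^-1 * g]invgK invgM invgK; exact: subgroupV.
apply/seteqP; split=> _ [h Hh <-].
  by exists (x^-1 * g * h); [exact: subgroupM|rewrite -!mulgA mulVKg].
by exists (g^-1 * x * h); [exact: subgroupM|rewrite -!mulgA mulVKg].
Qed.

(** * Translations and Haar measure on powers *)

Lemma second_countable_dense_seq (T : topologicalType) (a : T) :
  @second_countable T ->
  exists g : nat -> T, forall U, open U -> U !=set0 -> exists n, U (g n).
Proof.
case=> B /countable_injP[f finj] [oB bB].
exists (fun n => xget a [set x | exists2 V, B V /\ f V = n & V x]).
move=> U oU [x Ux].
have [V [BV Vx] VU] : filter_from [set V | B V /\ V x] id U.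
  by apply: bB; exact: open_nbhs_nbhs.
exists (f V); case: xgetP => [y -> [W [BW fWV] Wy]|/(_ x)[]]; last by exists V.
have WV : W = V by apply: finj; rewrite ?inE.
by apply: VU; move: Wy; rewrite WV.
Qed.

Lemma closed_borel_measurable (X : topGroupType) (A : set X) :
  closed A -> measurable (A : set (borel X)).
Proof.
move=> cA; rewrite -[A]setCK; apply: measurableC; apply: sub_sigma_algebra.
by rewrite openC.
Qed.

Lemma continuous_borel_preimage (X : topGroupType) (f : X -> X) (A : set X) :
  continuous f -> measurable (A : set (borel X)) ->
  measurable ([set x | A (f x)] : set (borel X)).
Proof.
move=> cf mA.
have : measurable_fun [set: borel X] (f : borel X -> borel X).
  apply: (@measurability _ _ (borel X) (borel X) setT f (@open X)) => //.
  move=> _ [U oU <-]; rewrite setTI; apply: sub_sigma_algebra.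
  exact: (open_preimageT cf).
by move=> /(_ measurableT _ mA); rewrite setTI.
Qed.

Lemma power_mulE (G : topGroupType) k (x y : power G k) (i : 'I_k) :
  (x * y) i = x i * y i.
Proof. by []. Qed.

(** Multiplication on the left by this element translates coordinate i by g and
fixes the other coordinates. *)
Definition coord_elt (G : topGroupType) k (i : 'I_k) (g : G) : power G k :=
  fun j => if j == i then g else 1.

Lemma image_lmul (G : groupType) (g : G) (A : set G) y :
  [set g * x | x in A] y -> A (g^-1 * y).
Proof. by move=> [x Ax <-]; rewrite mulKg. Qed.

(** A substitute for Fubini's theorem.  The subgroups [D x] do not depend on
coordinate [i], so that [x i] in [D x] describes a set whose fibres in the
direction of coordinate [i] are subgroups.  Fibres which are not open contribute
nothing to the measure: each has infinitely many disjoint translates. *)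
Lemma fiber_measure_le (R : realType) (G : topGroupType) k
  (mu : probability (borel (power G k)) R) (i : 'I_k)
  (D : power G k -> set G) (C : set (power G k)) :
  is_haar mu -> @second_countable G ->
  (forall x, subgroup (D x)) -> (forall x, closed (D x)) ->
  (forall g, closed [set x | D x g]) ->
  closed [set x | D x (x i)] ->
  (forall g x, D (coord_elt i g * x) = D x) ->
  closed C -> (forall x, open (D x) -> C x) ->
  (mu [set x | D x (x i)] <= mu C)%E.
Proof.
move=> hmu scG sD cD cDg cA Dinv cC DC.
have [g gdense] := second_countable_dense_seq (1 : G) scG.
pose A : set (power G k) := [set x | D x (x i)].
pose B n : set (power G k) :=
  A `&` \bigcap_(m in `I_n) ~` [set x | D x ((g m)^-1 * g n)].
pose tB n := [set coord_elt i (g n) * x | x in B n].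
have mB n : measurable (B n : set (borel (power G k))).
  apply: measurableI; first exact: closed_borel_measurable.
  apply: bigcap_measurableType => m _.
  by apply: measurableC; apply: closed_borel_measurable; exact: cDg.
have tBE n : tB n = [set x | B n ((coord_elt i (g n))^-1 * x)].
  apply/seteqP; split=> [y /image_lmul//|y By].
  by exists ((coord_elt i (g n))^-1 * y) => //; rewrite mulVKg.
have mtB n : measurable (tB n : set (borel (power G k))).
  rewrite tBE.
  apply: (@continuous_borel_preimage _ (fun x => (coord_elt i (g n))^-1 * x)) (mB n).
  exact: continuous_lmul.
(* A common point of two translates comes from points [x] and [z] of the same
   fibre, and then [g m] and [g n] represent the same coset of [D x]. *)
have disj : trivIset [set: nat] tB.
  apply: ltn_trivIset => n m ltmn.
  apply/seteqP; split=> // y [[x [Ax _] <-] [z [Az zB] zx]].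
  have Dzx : D z = D x by rewrite -(Dinv (g n) z) zx Dinv.
  have zxi : g n * z i = g m * x i.
    have := congr1 (fun u : power G k => u i) zx.
    by rewrite !power_mulE /coord_elt eqxx.
  apply: (zB m ltmn) => /=.
  have -> : (g m)^-1 * g n = x i * (z i)^-1.
    by rewrite -[x i](mulKg (g m)) -zxi -!mulgA mulgV mulg1.
  by have [_] := (subgroupE _).1 (sD z); apply=> //; rewrite Dzx.
have sumB : (\sum_(n <oo) mu (B n) < +oo)%E.
  apply: (@le_lt_trans _ _ 1%E); last exact: ltry.
  rewrite (eq_eseriesr (g := fun n => mu (tB n))); last first.
    by move=> n _; rewrite /tB (haar_left_invariant hmu).
  rewrite -measure_semi_bigcup//; last exact: bigcup_measurable.
  by apply: probability_le1; exact: bigcup_measurable.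
have lim0 := lim_sup_set_cvg0 mB sumB.
(* An [x] in finitely many [B n] has an open fibre. *)
have Acov : A `<=` lim_sup_set B `|` C.
  move=> x Ax; have [Cx|nCx] := pselect (C x); [by right|left].
  apply: contrapT => nlim; apply/nCx/DC.
  have [N NB] : exists N, forall n, (N <= n)%N -> ~ B n x.
    apply: contrapT => nN; apply: nlim => N _; apply: contrapT => nB.
    by apply: nN; exists N => n Nn Bn; apply: nB; exists n.
  apply: (@closed_subgroup_open _ _ g N (sD x) (cD x)).
  pose F := \bigcup_(m in `I_N) [set y | D x ((g m)^-1 * y)].
  (* From [N] on, each [g n] repeats the coset of an earlier term, and so
     eventually that of a term of index less than [N]. *)
  have gF n : F (g n).
    elim/ltn_ind: n => n IH; have [ltnN|leNn] := ltnP n N.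
      by exists n => //=; rewrite mulVg; exact: subgroup1.
    have [m ltmn Dmn] : exists2 m, (m < n)%N & D x ((g m)^-1 * g n).
      apply: contrapT => nm; apply: (NB n leNn); split=> // m ltmn Dmn.
      by apply: nm; exists m.
    have [l lN /= Dlm] := IH m ltmn; exists l => //=.
    by rewrite -(mulVKg (g m) (g n)) mulgA; exact: subgroupM.
  have cF : closed F.
    apply: closed_bigcup; first exact: finite_II.
    move=> m _; exact: (closed_preimageT (@continuous_lmul G (g m)^-1)).
  move=> y _; apply: contrapT => nFy.
  have [n] : exists n, (~` F) (g n).
    by apply: gdense; [rewrite openC|exists y].
  by apply; exact: gF.
have mC : measurable (C : set (borel (power G k))) by exact: closed_borel_measurable.
have mlim : measurable (lim_sup_set B : set (borel (power G k))).
  apply: bigcap_measurableType => n _; apply: bigcup_measurable => m _; exact: mB.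
apply: (@le_trans _ _ (mu (lim_sup_set B `|` C))).
  apply: le_measure => //; rewrite inE; first exact: closed_borel_measurable.
  exact: measurableU.
rewrite -[leRHS]add0e -lim0; exact: measureU2.
Qed.

(** * Peeling off the commutator word *)

Lemma left_normed_rcons (G : groupType) (s : seq G) (a : G) :
  s != [::] -> left_normed (rcons s a) = [~ left_normed s, a].
Proof. by case: s => //= x s _; rewrite foldl_rcons. Qed.

Lemma continuous_left_normed (G : topGroupType) k (s : seq 'I_k) :
  continuous (fun x : power G k => left_normed [seq x i | i <- s]).
Proof.
have proj_cts i : continuous (fun x : power G k => x i).
  exact: (@proj_continuous _ (fun _ : 'I_k => G) i).
elim/last_ind: s => [|s i IH]; first exact: cst_continuous.
have [->|s0] := eqVneq s [::]; first exact: proj_cts.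
under eq_fun do rewrite map_rcons left_normed_rcons -?size_eq0 ?size_map ?size_eq0//.
exact: continuous_commgf.
Qed.

(** Induction on the list of coordinates in the word.  Removing the last one
trades a coordinate for one more step in the series of relative centers, through
[fiber_measure_le]; with a single coordinate left, the fibre subgroup is the
constant [relative_center m]. *)
Lemma open_core_sub_relative_center (R : realType) (G : topGroupType) k
  (mu : probability (borel (power G k)) R) (s : seq 'I_k) m :
  is_haar mu -> @second_countable G -> hausdorff_space G ->
  uniq s -> s != [::] ->
  (0 < mu [set x : power G k |
     relative_center (@open_core G) m (left_normed [seq x i | i <- s])])%E ->
  @open_core G `<=` relative_center (@open_core G) (m + (size s).-1).
Proof.
move=> hmu scG hG; set H := @open_core G.
have Zsn n := relative_center_normal n (@conj_stable_open_core G).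
have cZ n : closed (relative_center H n).
  exact/closed_relative_center/accessible_closed_set1/hausdorff_accessible.
have cw t n :
    closed [set x : power G k | relative_center H n (left_normed [seq x j | j <- t])].
  exact: (closed_preimageT (@continuous_left_normed G k t)).
elim/last_ind: s m => // s i IH m; rewrite rcons_uniq => /andP[nsi us] _.
rewrite size_rcons /=; have [->|s0] := eqVneq s [::].
  rewrite addn0 /= => pos; apply: contrapT => nHZ.
  move: pos; apply/negP; rewrite -leNgt -(measure0 mu).
  apply: (@fiber_measure_le R G k mu i (fun=> relative_center H m)) => //.
  - by move=> x; exact: (Zsn m).1.
  - by move=> g c; apply: (@closed_preimageT _ _ (fun _ : power G k => g)) => //;
      exact: cst_continuous.
  - exact: (cw [:: i]).
  - exact: closed0.
  - by move=> x oZ; apply: nHZ => h; apply; split=> //; exact: (Zsn m).1.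
have wE x : left_normed [seq (x : power G k) j | j <- rcons s i] =
    [~ left_normed [seq x j | j <- s], x i].
  by rewrite map_rcons left_normed_rcons -?size_eq0 ?size_map ?size_eq0.
under eq_set do rewrite wE.
move=> pos; have -> : (m + size s = m.+1 + (size s).-1)%N.
  by rewrite addSnnS prednK// lt0n size_eq0.
apply: IH => //; apply: (lt_le_trans pos).
apply: (@fiber_measure_le R G k mu i (fun x =>
  [set y | relative_center H m [~ left_normed [seq x j | j <- s], y]])) => //.
- by move=> x; exact: subgroup_commutator_into (Zsn m).1 (Zsn m).2.
- move=> x; apply: (@closed_preimageT _ _ (fun y => [~ _, y])) => //.
  by apply: continuous_commgf; [exact: cst_continuous|move=> y; exact: cvg_id].
- move=> g; apply: (@closed_preimageT _ _ (fun x : power G k => [~ _, g])) => //.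
  apply: continuous_commgf; last exact: cst_continuous.
  exact: continuous_left_normed.
- have := cw (rcons s i) m.
  by under eq_set do rewrite wE.
- move=> g x.
  suff -> : [seq (coord_elt i g * x) j | j <- s] = [seq x j | j <- s] by [].
  apply/eq_in_map => j js; rewrite power_mulE /coord_elt.
  by case: eqP js nsi => [->->|]; rewrite ?mul1g.
- move=> x oD h Hh.
  apply: (Hh [set y | relative_center H m [~ left_normed [seq x j | j <- s], y]]).
  split=> //.
  exact: subgroup_commutator_into (Zsn m).1 (Zsn m).2.
Qed.

Theorem corollary3p13 (R : realType) (k : nat) (hk : (1 <= k)%N)
  (G : topGroupType) (hG : semialgebraic_lie_group R G)
  (hcompact : compact [set: G])
  (mu : probability (borel (power G k)) R) (hmu : is_haar mu)
  (hpos : (0 < mu [set x : power G k | comm_word x = 1%g])%E) :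
  exists H : set G,
    [/\ subgroup H, clopen H, finite_index H & nilpotent_of_class_le (k - 1) H].
Proof.
have [[hausG scG [d [A [[Acov _] _ _]]]] _] := hG.
have [c _ c1] := Acov 1.
have oH := open_open_core c1.
have sH := @subgroup_open_core G.
exists (@open_core G); split=> //.
- by split=> //; exact: open_subgroup_closed.
- exact: finite_index_open.
apply: nilpotent_relative_center => //; first exact: conj_stable_open_core.
have := @open_core_sub_relative_center R G k mu (enum 'I_k) 0 hmu scG hausG.
rewrite size_enum_ord add0n subn1; apply => //; first exact: enum_uniq.
by rewrite -size_eq0 size_enum_ord -lt0n.
Qed.
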